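(* Consider the one-dimensional parallel Schwarz method with Robin transmission conditions with $\alpha=ik$ (classical impedance conditions), and let $\mathcal{T}_{1d}$ be its iteration matrix for $N$ subdomains. Then for all $k>0$, $\sigma>0$, $\delta>0$ and $L>0$ the convergence factor $R_{1d}:=\lim_{N\to\infty}\rho(\mathcal{T}_{1d})$ satisfies $$R_{1d}<1.$$ Therefore the convergence of the Schwarz method will ultimately be independent of the number of subdomains $N$ (the method scales).
   Context: One-dimensional problem: on $\Omega=(a_1,b_N)$, $\mathcal{L}u:=-\partial_{xx}u+(ik\sigma-k^2)u=0$, with $\mathcal{B}_lu:=-\partial_xu+\alpha u=g_1$ at $x=a_1$ and $\mathcal{B}_ru:=\partial_xu+\alpha u=g_2$ at $x=b_N$. The domain is decomposed as $\Omega=\bigcup_{j=1}^N\Omega_j$, $\Omega_j=(a_j,b_j)$, with $b_j-a_j=L+2\delta$, $b_{j-1}-a_j=2\delta$, $a_{j+1}-a_j=b_{j+1}-b_j=L$; $L$ and $\delta$ are fixed as $N$ grows. The parallel Schwarz method computes $u_j^n$ from $\mathcal{L}u_j^n=0$ in $\Omega_j$, $\mathcal{B}_lu_j^n=\mathcal{B}_lu_{j-1}^{n-1}$ at $a_j$ (replaced by $\mathcal{B}_lu_1^n=g_1$ if $j=1$), $\mathcal{B}_ru_j^n=\mathcal{B}_ru_{j+1}^{n-1}$ at $b_j$ (replaced by $\mathcal{B}_ru_N^n=g_2$ if $j=N$). The errors' Robin interface data evolve by the stationary iteration with iteration matrix $\mathcal{T}_{1d}\in\mathbb{C}^{2(N-1)\times2(N-1)}$,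 the block tridiagonal block Toeplitz matrix with $2\times2$ blocks: diagonal blocks $A_0=\begin{bmatrix}0&b\\ b&0\end{bmatrix}$, first superdiagonal blocks $A_1=\begin{bmatrix}a&0\\0&0\end{bmatrix}$, first subdiagonal blocks $A_{-1}=\begin{bmatrix}0&0\\0&a\end{bmatrix}$, where $$a=\frac{(\zeta+\alpha)^2e^{2\zeta\delta}-(\zeta-\alpha)^2e^{-2\zeta\delta}}{(\zeta+\alpha)^2e^{\zeta(2\delta+L)}-(\zeta-\alpha)^2e^{-\zeta(2\delta+L)}},\qquad b=-\frac{(\zeta^2-\alpha^2)(e^{\zeta L}-e^{-\zeta L})}{(\zeta+\alpha)^2e^{\zeta(2\delta+L)}-(\zeta-\alpha)^2e^{-\zeta(2\delta+L)}},$$ and $\zeta=\sqrt{ik\sigma-k^2}$ (principal square root). $\rho$ denotes the spectral radius. *)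

(* Defs.v *)
From HB Require Import structures.
From mathcomp Require Import all_boot all_order all_algebra.
From mathcomp Require Import all_classical all_reals all_analysis.
From mathcomp Require Import complex.

Set Implicit Arguments.
Unset Strict Implicit.
Unset Printing Implicit Defensive.

Import Order.TTheory GRing.Theory Num.Theory.
Import numFieldNormedType.Exports.

Local Open Scope classical_set_scope.
Local Open Scope complex_scope.
Local Open Scope ring_scope.

Definition cexp (R : realType) (z : R[i]) : R[i] :=
  let: x +i* y := z in (expR x * cos y) +i* (expR x * sin y).

(* [eigenvalue] is about row eigenvectors, which gives the usual spectrum.
   The set is finite, and it is nonempty when n > 0; for n = 0 the value
   is sup set0 = 0. *)
Definition spectral_radius (R : realType) (n : nat) (A : 'M[R[i]]_n) : R :=
  sup [set Normc.normc x | x in [set x : R[i] | eigenvalue A x]].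

(* n x n blocks of size p x p: D on the diagonal, U on the first block
   superdiagonal, L on the first block subdiagonal. *)
Definition block_tridiag_toeplitz (T : nmodType) (n p : nat)
    (D U L : 'M[T]_p) : 'M[T]_(\sum_(i < n) p) :=
  \mxblock_(i < n, j < n)
    (if i == j :> nat then D
     else if j == i.+1 :> nat then U
     else if i == j.+1 :> nat then L
     else 0).

Section RobinSchwarz.
Variable R : realType.
Implicit Types (k sigma delta L : R) (alpha : R[i]).

(* [sqrtc] is the square root with nonnegative real part. *)
Definition zeta k sigma : R[i] :=
  sqrtc ((- k ^+ 2) +i* (k * sigma)).

Definition robin_den alpha k sigma delta L : R[i] :=
  let z := zeta k sigma in
  (z + alpha) ^+ 2 * cexp (z * (2 * delta + L)%:C)
  - (z - alpha) ^+ 2 * cexp (- (z * (2 * delta + L)%:C)).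

Definition robin_a alpha k sigma delta L : R[i] :=
  let z := zeta k sigma in
  ((z + alpha) ^+ 2 * cexp (2 * z * delta%:C)
   - (z - alpha) ^+ 2 * cexp (- (2 * z * delta%:C)))
  / robin_den alpha k sigma delta L.

Definition robin_b alpha k sigma delta L : R[i] :=
  let z := zeta k sigma in
  - ((z ^+ 2 - alpha ^+ 2) * (cexp (z * L%:C) - cexp (- (z * L%:C)))
     / robin_den alpha k sigma delta L).

(* Iteration matrix of the parallel Schwarz method with N subdomains and
   Robin parameter alpha, acting on the Robin data of the errors at the
   2(N-1) interfaces. *)
Definition T_1d alpha k sigma delta L (N : nat) :
    'M[R[i]]_(\sum_(i < N.-1) 2) :=
  let a := robin_a alpha k sigma delta L in
  let b := robin_b alpha k sigma delta L in
  block_tridiag_toeplitz N.-1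
    (b *: (delta_mx 0 1 + delta_mx 1 0))
    (a *: delta_mx 0 0)
    (a *: delta_mx 1 1).

Definition rho_1d alpha k sigma delta L (N : nat) : R :=
  spectral_radius (T_1d alpha k sigma delta L N).

(* [lim] is only meaningful together with a proof of convergence. *)
Definition R_1d alpha k sigma delta L : R :=
  limn (rho_1d alpha k sigma delta L).

End RobinSchwarz.

(* Main.v *)
Require Import Defs.
From mathcomp Require Import all_boot all_order all_algebra.
From mathcomp Require Import all_classical all_reals all_analysis.
From mathcomp Require Import complex ring lra zify.

Import Order.TTheory GRing.Theory Num.Theory.
Import numFieldNormedType.Exports.
Import Normc.

Local Open Scope classical_set_scope.
Local Open Scope complex_scope.
Local Open Scope ring_scope.

(** Let [a], [b] be the Robin coefficients and let [m] be the larger of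
    [|a + b|] and [|a - b|].  The limit of the spectral radii is [m], and
    [m < 1].

    For [l <> 0], eliminating one of the two interface unknowns from the
    eigenvalue equation leaves a three-term recurrence, whose characteristic
    roots [mu], [1 / mu] satisfy [mu + 1 / mu = 2 c] with
    [Q(l, c) = l^2 - 2 a l c + (a^2 - b^2) = 0]; the nonzero eigenvalues are
    the nonzero roots of a polynomial [W_n] of degree [2 n], where [n] is the
    number of interfaces.

    Upper bound.  If [c] is real in [[-1, 1]], the two roots of [Q( . , c)] are
    bounded by [m] ([symbol_eigenvalue_le]).  A root of [W_n] satisfies
    [mu^(2 (n + 1)) b^2 = (l - a mu)^2]
    ([interface_poly_root_joukowski]), which bounds [|mu|^n] and so puts [mu]
    within [O(1 / n)] of the unit circle, and [c] within [O(1 / n)] of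
    [[-1, 1]].  Hence every eigenvalue has modulus at most [m + o(1)]
    ([interface_poly_root_le]).

    Lower bound.  At the edge [l0 = a + b], where [c = 1], the values of [W_n]
    and of its derivative have closed forms, and their quotient shows that the
    sum of [1 / (l0 - w)] over the [2 n] roots [w] has order [n^2].
    So some root lies within [O(1 / n)] of [l0]
    ([interface_poly_root_near]).  Since [W_n] only depends on [b^2], the same
    is true at [a - b].

    Contraction.  The numbers [a + b] and [a - b] are quotients
    [w (delta - L / 2) / w (delta + L / 2)] of values of two solutions [w] of
    the homogeneous equation ([robin_abE]), and [|w|] is larger at
    [delta + L / 2] ([normc_robin_wave_lt]): writing [zeta = p + i q] with
    [q^2 = p^2 + k^2], the hyperbolic part of the increase dominates the
    oscillating part because [q sinh (2 p h) >= 2 p q h >= p |sin (2 q h)|]. *)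

(** * Contraction at the edges of the symbol *)

Lemma le_double_sinh (R : realType) (x : R) :
  0 <= x -> x *+ 2 <= expR x - expR (- x).
Proof.
move=> x0.
pose f (y : R) := expR y - expR (- y) - y *+ 2.
have dfE (y : R) : is_derive y 1 f (expR y + expR (- y) - 2).
  have -> : f = expR - (expR \o -%R) - (2 \*: id).
    by apply/funext => z; rewrite /f !fctE /= scaler_nat.
  apply: is_derive_eq.
  by rewrite scaler_nat mulrN1 opprK.
suff : f 0 <= f x by rewrite /f oppr0 expR0 subrr mul0rn subrr subr_ge0.
apply: (@ger0_derive1_ndecr _ f 0 x) => //.
- move=> y _; rewrite derive1E derive_val.
  have e0 := expR_gt0 y.
  have: expR y * expR (- y) = 1 by rewrite -expRD subrr expR0.
  have := sqr_ge0 (expR y - 1). nra.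
- by apply: continuous_subspaceT => y; apply/differentiable_continuous/derivable1_diffP.
Qed.

Lemma normr_sin_le (R : realType) (x : R) : 0 <= x -> `|sin x| <= x.
Proof.
move=> x0.
have [c _] := @MVT_segment R (@sin R) (@cos R) 0 x x0
  (fun y _ => is_derive_sin y) (continuous_subspaceT (@continuous_sin R)).
rewrite sin0 !subr0 => ->.
by rewrite normrM (ger0_norm x0) ler_piMl// ler_norml cos_geN1 cos_le1.
Qed.

Lemma zetaP (R : realType) (k sigma : R) : 0 < k -> 0 < sigma ->
  exists p q : R, [/\ zeta k sigma = p +i* q, 0 < p, 0 < q & q ^+ 2 = p ^+ 2 + k ^+ 2].
Proof.
move=> k0 s0; have := sqr_sqrtc ((- k ^+ 2) +i* (k * sigma)).
have: 0 <= complex.Re (zeta k sigma) by rewrite /zeta /sqrtc; exact: sqrtr_ge0.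
rewrite -/(zeta k sigma); case: (zeta k sigma) => p q /= p0.
rewrite expr2 => /eqP; rewrite eq_complex /= => /andP[/eqP re /eqP im].
have pq : 0 < p * q by have := mulr_gt0 k0 s0; lra.
have pp : 0 < p by rewrite lt_neqAle p0 andbT; apply: contraTneq pq => <-; rewrite mul0r ltxx.
exists p, q; split=> //; first by rewrite -(pmulr_rgt0 _ pp).
lra.
Qed.

Lemma cexpD (R : realType) (z w : R[i]) : cexp (z + w) = cexp z * cexp w.
Proof.
case: z w => [x y] [u v] /=; apply/eqP; rewrite eq_complex /= expRD cosD sinD.
by apply/andP; split; apply/eqP; ring.
Qed.

Lemma cexp0 (R : realType) : cexp 0 = 1 :> R[i].
Proof. by rewrite /cexp /= expR0 cos0 sin0 mulr1 mulr0. Qed.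

(** Up to the factor 2, this solution of [w'' = z^2 w] is
    [z cosh (z t) + alpha sinh (z t)] for [s = 1] and
    [z sinh (z t) + alpha cosh (z t)] for [s = - 1]. *)
Definition robin_wave {R : realType} (alpha z : R[i]) (s t : R) : R[i] :=
  (z + alpha) * cexp (z * t%:C) + s%:C * ((z - alpha) * cexp (- (z * t%:C))).

Lemma normc_sqr (R : rcfType) (z : R[i]) : normc z ^+ 2 = complex.Re z ^+ 2 + complex.Im z ^+ 2.
Proof. by case: z => x y /=; rewrite sqr_sqrtr ?addr_ge0 ?sqr_ge0. Qed.

Lemma normc_ge0 (R : rcfType) (z : R[i]) : 0 <= normc z.
Proof. by case: z => x y; exact: sqrtr_ge0. Qed.

(** The factor [q] in front of the hyperbolic part and the factor [p] in front
    of the oscillating part come from [|zeta|^2 + k^2 = 2 q^2] and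
    [|zeta|^2 - k^2 = 2 p^2]. *)
Lemma sqr_normc_robin_wave (R : realType) (k p q s t : R) :
  q ^+ 2 = p ^+ 2 + k ^+ 2 -> s ^+ 2 = 1 ->
  normc (robin_wave (0 +i* k) (p +i* q) s t) ^+ 2 =
  2 * (q * ((q + k) * expR (2 * p * t) + (q - k) * expR (- (2 * p * t)))
  + 2 * s * p * (p * cos (2 * q * t) - k * sin (2 * q * t))).
Proof.
move=> qE s1; rewrite normc_sqr /robin_wave /= !(mulr0, mul0r, subr0, addr0, add0r).
have -> : 2 * p * t = p * t + p * t by ring.
have -> : 2 * q * t = q * t + q * t by ring.
rewrite opprD !expRD cosD sinD cosN sinN.
have : expR (p * t) * expR (- (p * t)) = 1 by rewrite -expRD subrr expR0.
have := cos2Dsin2 (q * t).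
set E := expR _; set F := expR _; set C := cos _; set S := sin _ => cs ef.
transitivity ((p ^+ 2 + (q + k) ^+ 2) * E ^+ 2 * (C ^+ 2 + S ^+ 2)
  + s ^+ 2 * (p ^+ 2 + (q - k) ^+ 2) * F ^+ 2 * (C ^+ 2 + S ^+ 2)
  + 2 * s * (E * F) * ((p ^+ 2 + q ^+ 2 - k ^+ 2) * (C ^+ 2 - S ^+ 2) - 4 * k * p * (S * C))).
  by ring.
rewrite cs s1 ef.
transitivity (2 * (q * ((q + k) * (E * E) + (q - k) * (F * F))
    + 2 * s * p * (p * (C * C - S * S) - k * (S * C + C * S)))
  + (p ^+ 2 + k ^+ 2 - q ^+ 2) * (E ^+ 2 + F ^+ 2 - 2 * s * (C ^+ 2 - S ^+ 2))).
  by ring.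
by rewrite qE subrr mul0r addr0; ring.
Qed.

(** In the difference of the squared moduli, the hyperbolic part is the product
    of [q (e^y - e^-y)] and [q (e^x - e^-x) + k (e^x + e^-x)] with [x = 2 p d]
    and [y = 2 p h], and the oscillating part is a product of sines and cosines
    in [2 q d] and [2 q h] that is dominated factor by factor. *)
Lemma normc_robin_wave_lt (R : realType) (k p q s d h : R) :
  0 < k -> 0 < p -> 0 < q -> q ^+ 2 = p ^+ 2 + k ^+ 2 -> s ^+ 2 = 1 ->
  0 < d -> 0 < h ->
  normc (robin_wave (0 +i* k) (p +i* q) s (d - h)) <
  normc (robin_wave (0 +i* k) (p +i* q) s (d + h)).
Proof.
move=> k0 p0 q0 qE s1 d0 h0.
rewrite -(ltr_pXn2r (ltn0Sn 1)) ?nnegrE ?normc_ge0// !sqr_normc_robin_wave//.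
rewrite ltr_pM2l ?ltr0n// -subr_gt0 !(mulrDr _ d) mulrN mulrN.
rewrite !opprD opprK !expRD !(cosD, sinD) !(cosN, sinN).
have ph0 : 0 <= 2 * p * h by rewrite !mulr_ge0// ltW.
have qh0 : 0 <= 2 * q * h by rewrite !mulr_ge0// ltW.
have pd0 : 0 <= 2 * p * d by rewrite !mulr_ge0// ltW.
have qd0 : 0 <= 2 * q * d by rewrite !mulr_ge0// ltW.
have h1 := le_double_sinh _ _ ph0.
have h2 := normr_sin_le _ _ qh0.
have d1 := le_double_sinh _ _ pd0.
have d2 := normr_sin_le _ _ qd0.
have ch : 2 < expR (2 * p * d) + expR (- (2 * p * d)).
  have pd : 0 < 2 * p * d by rewrite !mulr_gt0.
  have := expR_gt1Dx (lt0r_neq0 pd).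
  have : - (2 * p * d) != 0 by rewrite oppr_eq0 lt0r_neq0.
  by move/expR_gt1Dx; lra.
have cd : `|cos (2 * q * d)| <= 1 by rewrite ler_norml cos_geN1 cos_le1.
have sn : `|s| = 1 by apply/eqP; rewrite -sqrp_eq1// -normrX s1 normr1.
set E := expR (2 * p * d) in d1 ch *; set E' := expR (- (2 * p * d)) in d1 ch *.
set F := expR (2 * p * h) in h1 *; set F' := expR (- (2 * p * h)) in h1 *.
set S := sin (2 * q * d) in d2 *; set C := cos (2 * q * d) in cd *.
set S' := sin (2 * q * h) in h2 *; set C' := cos (2 * q * h).
rewrite [X in 0 < X](_ : _ = q * (F - F') * (q * (E - E') + k * (E + E'))
  - 4 * p * (s * (S' * (p * S + k * C)))); last by ring.
rewrite subr_gt0; apply: (@le_lt_trans _ _ (4 * p * (`|S'| * (p * `|S| + k * `|C|)))).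
  rewrite ler_pM2l ?mulr_gt0//; apply: le_trans (ler_norm _) _.
  rewrite !normrM sn mul1r ler_wpM2l//; apply: le_trans (ler_normD _ _) _.
  by rewrite !normrM (gtr0_norm p0) (gtr0_norm k0).
have A1 : 2 * p * `|S'| <= q * (F - F').
  have := ler_wpM2l (ltW q0) h1; have := ler_wpM2l (ltW p0) h2; lra.
have A2 : 2 * p * `|S| <= q * (E - E').
  have := ler_wpM2l (ltW q0) d1; have := ler_wpM2l (ltW p0) d2; lra.
have A3 : 2 * k * `|C| < k * (E + E').
  have := ltr_pM2l k0 2 (E + E'); rewrite ch => /idP.
  have := ler_wpM2l (ltW k0) cd; lra.
have A4 : 0 < q * (F - F').
  rewrite mulr_gt0//; apply: lt_le_trans h1.
  by rewrite pmulrn_lgt0// !mulr_gt0.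
have -> : 4 * p * (`|S'| * (p * `|S| + k * `|C|))
  = (2 * p * `|S'|) * (2 * p * `|S| + 2 * k * `|C|) by ring.
apply: le_lt_trans (_ : q * (F - F') * (2 * p * `|S| + 2 * k * `|C|) < _).
  by rewrite ler_wpM2r// addr_ge0// !mulr_ge0// ltW.
by rewrite ltr_pM2l//; lra.
Qed.

(** This difference of squares factors both the denominator of the Robin
    coefficients, at [t = delta + L / 2], and the numerator of [a], at
    [t = delta]. *)
Lemma mul_robin_wave (R : realType) (al z : R[i]) (s t : R) : s ^+ 2 = 1 ->
  robin_wave al z s t * robin_wave al z (- s) t =
  (z + al) ^+ 2 * cexp (z * (t *+ 2)%:C) - (z - al) ^+ 2 * cexp (- (z * (t *+ 2)%:C)).
Proof.
move=> s1; have sC1 : s%:C ^+ 2 = 1 :> R[i] by rewrite -rmorphXn s1.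
rewrite /robin_wave rmorphN mulr2n rmorphD (mulrDr z) opprD !cexpD.
set X := cexp _; set Y := cexp _.
transitivity ((z + al) ^+ 2 * (X * X) - s%:C ^+ 2 * (z - al) ^+ 2 * (Y * Y)).
  by ring.
by rewrite sC1 mul1r.
Qed.

Lemma robin_wave_neq0 (R : realType) (k sigma s t : R) :
  0 < k -> 0 < sigma -> s ^+ 2 = 1 -> 0 < t ->
  robin_wave (0 +i* k) (zeta k sigma) s t != 0.
Proof.
move=> k0 s0 s1 t0; have [p [q [zE p0 q0 qE]]] := zetaP _ _ _ k0 s0.
have t2 : 0 < t / 2 by rewrite divr_gt0.
apply: contraTneq (normc_robin_wave_lt _ _ _ _ _ _ _ k0 p0 q0 qE s1 t2 t2).
by rewrite -zE -splitr => ->; rewrite normc0 -leNgt normc_ge0.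
Qed.

Lemma robin_den_neq0 (R : realType) (k sigma d L : R) :
  0 < k -> 0 < sigma -> 0 < d -> 0 < L -> robin_den (0 +i* k) k sigma d L != 0.
Proof.
move=> k0 s0 d0 L0; rewrite /robin_den; cbv zeta.
have t0 : 0 < d + L / 2 by rewrite addr_gt0// divr_gt0.
have -> : 2 * d + L = (d + L / 2) *+ 2 by rewrite [RHS]mulr2n; lra.
rewrite -(mul_robin_wave _ _ _ 1) ?expr1n//.
by apply: mulf_neq0; apply: robin_wave_neq0; rewrite ?sqrrN ?expr1n.
Qed.

Lemma robin_a_neq0 (R : realType) (k sigma d L : R) :
  0 < k -> 0 < sigma -> 0 < d -> 0 < L -> robin_a (0 +i* k) k sigma d L != 0.
Proof.
move=> k0 s0 d0 L0.
apply: mulf_neq0; last by rewrite invr_eq0; exact: robin_den_neq0.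
have dE (z : R[i]) : 2 * z * d%:C = z * (d *+ 2)%:C.
  by rewrite rmorphMn [_ *+ 2]mulr2n; ring.
rewrite dE -(mul_robin_wave _ _ _ 1) ?expr1n//.
by apply: mulf_neq0; apply: robin_wave_neq0; rewrite ?sqrrN ?expr1n.
Qed.

Lemma normc_cexp (R : realType) (z : R[i]) : normc (cexp z) = expR (complex.Re z).
Proof.
case: z => x y /=; rewrite !exprMn -mulrDr cos2Dsin2 mulr1 sqrtr_sqr.
by rewrite ger0_norm ?expR_ge0.
Qed.

Lemma robin_b_neq0 (R : realType) (k sigma d L : R) :
  0 < k -> 0 < sigma -> 0 < d -> 0 < L -> robin_b (0 +i* k) k sigma d L != 0.
Proof.
move=> k0 s0 d0 L0; rewrite /robin_b; cbv zeta.
rewrite oppr_eq0; apply: mulf_neq0; last first.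
  by rewrite invr_eq0; exact: robin_den_neq0.
apply: mulf_neq0.
  rewrite /zeta sqr_sqrtc subr_eq0; apply/eqP => /(congr1 (@complex.Im R)) /=.
  by rewrite !(mul0r, mulr0) addr0; apply/eqP; rewrite mulf_neq0 ?lt0r_neq0.
have [p [q [-> p0 _ _]]] := zetaP _ _ _ k0 s0.
rewrite subr_eq0; apply/eqP => /(congr1 (@normc R)); rewrite !normc_cexp /=.
move/expR_inj; rewrite mulr0 subr0 => e.
by have := mulr_gt0 p0 L0; lra.
Qed.

(** The numerator of [a - s b] factors as the wave [s] at [d - h] times the wave
    [- s] at [d + h], and the second factor cancels against the denominator. *)
Lemma robin_abE (R : realType) (k sigma d h s : R) :
  0 < k -> 0 < sigma -> 0 < d -> 0 < h -> s ^+ 2 = 1 ->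
  robin_a (0 +i* k) k sigma d (h *+ 2) - s%:C * robin_b (0 +i* k) k sigma d (h *+ 2)
  = robin_wave (0 +i* k) (zeta k sigma) s (d - h)
    / robin_wave (0 +i* k) (zeta k sigma) s (d + h).
Proof.
move=> k0 s0 d0 h0 s1.
have nz1 : robin_wave (0 +i* k) (zeta k sigma) s (d + h) != 0.
  by rewrite robin_wave_neq0// addr_gt0.
have nz2 : robin_wave (0 +i* k) (zeta k sigma) (- s) (d + h) != 0.
  by rewrite robin_wave_neq0 ?sqrrN// addr_gt0.
rewrite /robin_a /robin_b /robin_den; cbv zeta; move: nz1 nz2.
move: (0 +i* k) (zeta k sigma) => al z nz1 nz2.
have sC1 : s%:C ^+ 2 = 1 :> R[i] by rewrite -rmorphXn s1.
have denE : (z + al) ^+ 2 * cexp (z * (2 * d + h *+ 2)%:C)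
      - (z - al) ^+ 2 * cexp (- (z * (2 * d + h *+ 2)%:C)) =
    robin_wave al z s (d + h) * robin_wave al z (- s) (d + h).
  by rewrite mul_robin_wave// mulrnDl mulr_natl.
have numE : (z + al) ^+ 2 * cexp (2 * z * d%:C) - (z - al) ^+ 2 * cexp (- (2 * z * d%:C))
   + s%:C * ((z ^+ 2 - al ^+ 2) * (cexp (z * (h *+ 2)%:C) - cexp (- (z * (h *+ 2)%:C))))
   = robin_wave al z s (d - h) * robin_wave al z (- s) (d + h).
  rewrite /robin_wave rmorphN rmorphMn !rmorphD rmorphN mulr2n.
  have -> : 2 * z * d%:C = z * d%:C + z * d%:C by ring.
  rewrite !mulrDr !mulrN !opprD !opprK !cexpD.
  have e1 : cexp (z * d%:C) * cexp (- (z * d%:C)) = 1 by rewrite -cexpD subrr cexp0.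
  have e2 : cexp (z * h%:C) * cexp (- (z * h%:C)) = 1 by rewrite -cexpD subrr cexp0.
  set X := cexp (z * d%:C) in e1 *; set X' := cexp (- (z * d%:C)) in e1 *.
  set Y := cexp (z * h%:C) in e2 *; set Y' := cexp (- (z * h%:C)) in e2 *.
  transitivity ((z + al) ^+ 2 * (X * X) * (Y * Y') - s%:C ^+ 2 * (z - al) ^+ 2 * (X' * X') * (Y * Y')
    + s%:C * ((z ^+ 2 - al ^+ 2) * (X * X') * (Y * Y - Y' * Y'))).
    by rewrite e1 e2 sC1 !mulr1 mul1r mulrBr mulrBr.
  by ring.
rewrite mulrN opprK mulrA -mulrDl numE denE.
by rewrite -mulf_div divff// mulr1.
Qed.

(** * Eigenvalues of the symbol *)

Lemma normc_triangle (R : rcfType) (x y : R[i]) : normc (x + y) <= normc x + normc y.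
Proof. exact: le_normcD. Qed.

Lemma normc_opp (R : rcfType) (x : R[i]) : normc (- x) = normc x.
Proof. exact: normcN. Qed.

Lemma normc_exp (R : rcfType) (x : R[i]) n : normc (x ^+ n) = normc x ^+ n.
Proof. by elim: n => [|n IH]; rewrite ?expr0 ?normc1// !exprS normcM IH. Qed.

Lemma normc_real (R : rcfType) (x : R) : normc x%:C = `|x|.
Proof. by rewrite /= expr0n addr0 sqrtr_sqr. Qed.

Lemma normc_nat (R : rcfType) n : normc (n%:R : R[i]) = n%:R.
Proof. by rewrite -(rmorph_nat (real_complex R)) normc_real normr_nat. Qed.

Lemma normc_eq0 (R : rcfType) (x : R[i]) : (normc x == 0) = (x == 0).
Proof. by apply/eqP/eqP => [/eq0_normc//|->]; rewrite normc0. Qed.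

Lemma normc_parallelogram (R : rcfType) (x y : R[i]) :
  normc (x + y) ^+ 2 + normc (x - y) ^+ 2 = 2 * (normc x ^+ 2 + normc y ^+ 2).
Proof. by rewrite !normc_sqr; case: x y => [x x'] [y y'] /=; ring. Qed.

(** With [l] and [l'] the two roots, [|l|^2 |l'|^2 = |a + b|^2 |a - b|^2],
    and the parallelogram identity gives
    [|l|^2 + |l'|^2 <= |a + b|^2 + |a - b|^2].  Two nonnegative numbers with the
    same product as another pair and a smaller sum lie between the members of
    that pair. *)
Lemma symbol_eigenvalue_le (R : rcfType) (a b l : R[i]) (c : R) :
  `|c| <= 1 -> l ^+ 2 - 2 * a * l * c%:C + (a ^+ 2 - b ^+ 2) = 0 ->
  normc l <= Num.max (normc (a + b)) (normc (a - b)).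
Proof.
move=> c1 lE.
(* The other root of the quadratic equation. *)
pose l' := 2 * a * c%:C - l.
have ll' : l * l' = (a + b) * (a - b).
  by apply/eqP; rewrite -subr_eq0 -oppr_eq0 -lE; apply/eqP; rewrite /l'; ring.
have c2 : c ^+ 2 <= 1 by move: c1; rewrite ler_norml => /andP[c1 c1p]; nra.
have c2' := sqr_ge0 c.
have half : normc (l - a * c%:C) ^+ 2 <=
    c ^+ 2 * normc b ^+ 2 + (1 - c ^+ 2) * (normc a ^+ 2 + normc b ^+ 2).
  have sqE : (l - a * c%:C) ^+ 2 =
      (c ^+ 2)%:C * b ^+ 2 + (1 - c ^+ 2)%:C * ((b - a) * (b + a)).
    apply/eqP; rewrite -subr_eq0 -lE rmorphB rmorph1 rmorphXn; apply/eqP; ring.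
  rewrite -normc_exp sqE; apply: le_trans (normc_triangle _ _ _) _.
  rewrite (normcM _ (b ^+ 2)) normc_exp !normcM !normc_real ger0_norm// ger0_norm ?subr_ge0//.
  rewrite lerD2l ler_wpM2l ?subr_ge0//.
  have := normc_parallelogram _ b a.
  have := sqr_ge0 (normc (b - a) - normc (b + a)); lra.
have sumle : normc l ^+ 2 + normc l' ^+ 2 <= normc (a + b) ^+ 2 + normc (a - b) ^+ 2.
  have := normc_parallelogram _ (a * c%:C) (l - a * c%:C).
  rewrite subrKC (_ : a * c%:C - (l - a * c%:C) = l'); last by rewrite /l'; ring.
  rewrite normc_parallelogram => ->; rewrite ler_pM2l//.
  rewrite normcM exprMn normc_real real_normK ?num_real//; lra.
have prodE : normc l ^+ 2 * normc l' ^+ 2 = normc (a + b) ^+ 2 * normc (a - b) ^+ 2.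
  by rewrite -!exprMn -!normcM ll'.
have sq2 : normc l ^+ 2 <= Num.max (normc (a + b)) (normc (a - b)) ^+ 2.
  move: (sqr_ge0 (normc l)) sumle prodE.
  set s := normc l ^+ 2; set s' := normc l' ^+ 2 => s0 sumle prodE.
  set M := Num.max _ _ ^+ 2; rewrite leNgt; apply/negP => Ms.
  have [M1 M2] : normc (a + b) ^+ 2 <= M /\ normc (a - b) ^+ 2 <= M.
    by split; rewrite ler_sqr ?nnegrE ?le_max ?normc_ge0 ?lexx ?orbT.
  have : 0 < (s - normc (a + b) ^+ 2) * (s - normc (a - b) ^+ 2).
    by rewrite mulr_gt0// subr_gt0; apply: le_lt_trans Ms.
  have := ler_wpM2l s0 sumle; lra.
by move: sq2; rewrite ler_sqr ?nnegrE ?le_max ?normc_ge0.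
Qed.

(** This is [|p' / p| <= deg p / e], from the logarithmic derivative as a sum
    over the roots; stated without quotients, it also covers a zero of [p]. *)
Lemma deriv_le_of_far_roots (R : rcfType) (r : seq R[i]) (z : R[i]) (e : R) :
  0 <= e -> (forall w, w \in r -> e <= normc (z - w)) ->
  let p := \prod_(w <- r) ('X - w%:P) in
  e * normc p^`().[z] <= (size r)%:R * normc p.[z].
Proof.
move=> e0; elim: r => [|w r IH] far /=.
  by rewrite big_nil derivC horner0 normc0 mulr0 mul0r.
rewrite big_cons derivM derivXsubC mul1r !hornerE.
have {}IH := IH (fun x xr => far x (mem_behead (s := w :: r) xr)).
rewrite /= in IH; move: IH; set q := \prod_(_ <- _) _ => IH.
apply: le_trans (_ : e * (normc q.[z] + normc (z - w) * normc q^`().[z]) <= _).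
  by rewrite ler_wpM2l// -normcM normc_triangle.
have h1 := ler_wpM2r (normc_ge0 _ q.[z]) (far w (mem_head _ _)).
have h2 := ler_wpM2l (normc_ge0 _ (z - w)) IH.
rewrite normcM -natr1; lra.
Qed.

(** * A polynomial whose roots are the eigenvalues *)

(** With [t = a X] and [2 c = X / a + (a^2 - b^2) / (a X)], this is
    [t^n (U_n(c) - (a / X) U_(n-1)(c))] for the Chebyshev polynomials [U] of the
    second kind, that is [t^n] times the interface unknown [x n] normalized by [x 0 = 1]. *)
Fixpoint interface_poly {F : nzRingType} (a b : F) (n : nat) : {poly F} :=
  match n with
  | 0 => 1
  | 1 => 'X^2 - (b ^+ 2)%:P
  | (n'.+1 as m).+1 =>
      ('X^2 + (a ^+ 2 - b ^+ 2)%:P) * interface_poly a b m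
      - (a ^+ 2)%:P * 'X^2 * interface_poly a b n'
  end.

Lemma interface_polySS (F : nzRingType) (a b : F) n :
  interface_poly a b n.+2 = ('X^2 + (a ^+ 2 - b ^+ 2)%:P) * interface_poly a b n.+1
    - (a ^+ 2)%:P * 'X^2 * interface_poly a b n.
Proof. by []. Qed.

Lemma nat_pair_ind (P : nat -> Prop) :
  P 0%N -> P 1%N -> (forall n, P n -> P n.+1 -> P n.+2) -> forall n, P n.
Proof.
move=> P0 P1 PS n; suff [] : P n /\ P n.+1 by [].
by elim: n => [|n [Pn PSn]]; split=> //; apply: PS.
Qed.

Lemma size_interface_poly (F : idomainType) (a b : F) n :
  size (interface_poly a b n) = n.*2.+1 /\ interface_poly a b n \is monic.
Proof.
elim/nat_pair_ind: n => [||n [sn _] [sn1 mn1]].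
- by rewrite size_poly1 monic1.
- by rewrite /= size_XnsubC// monicXnsubC.
have sS : size (('X^2 + (a ^+ 2 - b ^+ 2)%:P) * interface_poly a b n.+1) = n.+2.*2.+1.
  by rewrite size_Mmonic ?monic_neq0 ?monicXnaddC// size_XnaddC// sn1; lia.
have lt : (size (- ((a ^+ 2)%:P * 'X^2 * interface_poly a b n)) < n.+2.*2.+1)%N.
  rewrite size_polyN; have := size_polyC_leq1 (a ^+ 2).
  have := size_polyMleq (a ^+ 2)%:P 'X^2.
  have := size_polyMleq ((a ^+ 2)%:P * 'X^2) (interface_poly a b n).
  rewrite size_polyXn sn; set s1 := size _; set s2 := size _; set s3 := size _; lia.
rewrite interface_polySS; split; first by rewrite size_polyDl sS.
by rewrite monicE lead_coefDl ?sS// -monicE monicMl ?monicXnaddC.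
Qed.

(** At [l = a + b] the characteristic roots of the recurrence coincide, so the
    solution is a power times a polynomial of degree 1 in [n]; differentiating
    with respect to [l] raises that degree to 3 in the next lemma. *)
Lemma interface_poly_edge (F : comNzRingType) (a b : F) n :
  (a + b) * (interface_poly a b n).[a + b] = (a * (a + b)) ^+ n * (a + b + n%:R * b).
Proof.
elim/nat_pair_ind: n => [||n IH IH1].
- by rewrite hornerC expr0 mul0r addr0 mulr1 mul1r.
- by rewrite /= !hornerE; ring.
rewrite interface_polySS !(hornerD, hornerN, hornerM, hornerC, hornerX).
set p := _.[_] in IH *; set p1 := _.[_] in IH1 *.
transitivity (((a + b) ^+ 2 + (a ^+ 2 - b ^+ 2)) * ((a + b) * p1)
   - a ^+ 2 * (a + b) ^+ 2 * ((a + b) * p)); first by ring.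
by rewrite IH IH1 !exprS -!natr1; ring.
Qed.

Lemma deriv_interface_poly_edge (F : comNzRingType) (a b : F) n :
  3 * a * (a + b) ^+ 2 * (interface_poly a b n)^`().[a + b]
  = (a * (a + b)) ^+ n * n%:R * (6 * (a + b) ^+ 2 + 6 * b * (a + b) * (n%:R - 1)
      + b ^+ 2 * (n%:R - 1) * (n%:R - 2)).
Proof.
elim/nat_pair_ind: n => [||n IH IH1].
- by rewrite derivC horner0 mulr0 !mulr0 mul0r.
- by rewrite /= derivB derivXn derivC subr0 hornerMn hornerX /=; ring.
have e0 := interface_poly_edge _ a b n.
have e1 := interface_poly_edge _ a b n.+1.
rewrite interface_polySS derivB !derivM derivD derivXn derivX -polyC1 !derivC
  !(hornerD, hornerN, hornerM, hornerC, hornerX, hornerMn) /=.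
move: IH IH1 e0 e1; set p := _.[_]; set p1 := _.[_]; set q := _.[_]; set q1 := _.[_].
move=> IH IH1 e0 e1.
transitivity (((a + b) ^+ 2 + (a ^+ 2 - b ^+ 2)) * (3 * a * (a + b) ^+ 2 * p1)
   - a ^+ 2 * (a + b) ^+ 2 * (3 * a * (a + b) ^+ 2 * p)
   + 6 * a * (a + b) ^+ 2 * ((a + b) * q1) - 6 * a ^+ 3 * (a + b) ^+ 2 * ((a + b) * q)).
  by ring.
by rewrite IH IH1 e0 e1 !exprS -!natr1; ring.
Qed.

(** If all the roots were at distance at least [e] from [a + b], the derivative,
    of order [n^3] after division by the power of [a (a + b)], would be bounded
    by [2 n / e] times the value, of order [n]. *)
Lemma interface_poly_root_close (R : rcfType) (a b : R[i]) (e : R) n :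
  a != 0 -> b != 0 -> a + b != 0 -> 0 < e -> (2 <= n)%N ->
  let A := normc a in let B := normc b in let l := normc (a + b) in
  6 * e * l ^+ 2 + 6 * e * B * l + 6 * A * l * (l + B) < e * B ^+ 2 * (n%:R - 3) ->
  exists2 w, root (interface_poly a b n) w & normc (a + b - w) < e.
Proof.
move=> a0 b0 l0 e0 n2 A B l; set K := _ + _ * (l + B) => NP.
have B0 : 0 < B by rewrite lt_neqAle eq_sym normc_eq0 b0 normc_ge0.
have Age0 : 0 <= A := normc_ge0 _ _.
have lge0 : 0 <= l := normc_ge0 _ _.
have [//|no] := pselect (exists2 w, root (interface_poly a b n) w & normc (a + b - w) < e).
exfalso.
have [sz mn] := size_interface_poly _ a b n.
have [r rE] := closed_field_poly_normal (interface_poly a b n).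
rewrite (monicP mn) scale1r in rE.
have szr : size r = n.*2.
  by move: sz; rewrite rE size_prod_XsubC => -[].
have far w : w \in r -> e <= normc (a + b - w).
  move=> wr; rewrite leNgt; apply/negP => lt; apply: no; exists w => //.
  by rewrite rE root_prod_XsubC.
have := deriv_le_of_far_roots _ r (a + b) e (ltW e0) far; rewrite -rE szr => H.
have E0 := congr1 (@normc R) (interface_poly_edge _ a b n).
have E1 := congr1 (@normc R) (deriv_interface_poly_edge _ a b n).
rewrite /= in H; move: E0 E1 H.
set W := interface_poly a b n.
case: n n2 NP @W {no sz mn rE szr} => [|[|m]]// _ NP W.
rewrite (_ : m.+2%:R - 1 = m.+1%:R); last by rewrite -!natr1; ring.
rewrite (_ : m.+2%:R - 2 = m%:R); last by rewrite -!natr1; ring.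
rewrite -muln2 natrM.
rewrite !(normc_exp, normcM, normc_nat) -/A -/l -/B.
set P := normc (a + b + _); set Q := normc (_ + _ + _).
set T := (A * l) ^+ _; set w := normc _; set w' := normc _ => E0 E1 H.
have l00 : 0 < l by rewrite lt_neqAle eq_sym normc_eq0 l0 normc_ge0.
have A0 : 0 < A by rewrite lt_neqAle eq_sym normc_eq0 a0 normc_ge0.
have T0 : 0 < T by rewrite exprn_gt0// mulr_gt0.
have PE : P <= l + m.+2%:R * B.
  by apply: le_trans (normc_triangle _ _ _) _; rewrite normcM normc_nat.
have QE : B ^+ 2 * m.+1%:R * m%:R <= Q + 6 * l ^+ 2 + 6 * B * l * m.+1%:R.
  rewrite /Q; set x := 6 * (a + b) ^+ 2; set y := 6 * b * (a + b) * _; set z := b ^+ 2 * _ * _.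
  have -> : B ^+ 2 * m.+1%:R * m%:R = normc (x + y + z - x - y).
    rewrite (_ : x + y + z - x - y = z); last by ring.
    by rewrite !(normc_exp, normcM, normc_nat).
  apply: le_trans (normc_triangle _ _ _) _; rewrite normc_opp.
  apply: lerD; last by rewrite !(normc_exp, normcM, normc_nat).
  apply: le_trans (normc_triangle _ _ _) _; rewrite normc_opp.
  by rewrite lerD2l !(normc_exp, normcM, normc_nat).
have eQ : e * Q <= 6 * A * l * P.
  have c0 : 0 < T * m.+2%:R by rewrite mulr_gt0.
  rewrite -(ler_pM2l c0) mulrCA -E1.
  rewrite (_ : T * m.+2%:R * (6 * A * l * P) = m.+2%:R * (6 * A * l) * (T * P)); last by ring.
  rewrite -E0.
  have -> : e * (3 * A * l ^+ 2 * w') = 3 * A * l ^+ 2 * (e * w') by ring.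
  have -> : m.+2%:R * (6 * A * l) * (l * w) = 3 * A * l ^+ 2 * (m.+2%:R * 2 * w) by ring.
  by rewrite ler_pM2l// !mulr_gt0// exprn_gt0.
have m0 : 0 <= m%:R :> R by rewrite ler0n.
have mE : m.+2%:R = m%:R + 2 :> R by rewrite -addn2 natrD.
have mE1 : m.+1%:R = m%:R + 1 :> R by rewrite -addn1 natrD.
rewrite {}mE in PE NP; rewrite {}mE1 in QE.
have K2 : K < e * B ^+ 2 * (m%:R - 1).
  apply: lt_le_trans NP _; rewrite ler_pM2l ?mulr_gt0 ?exprn_gt0//; lra.
have := ler_wpM2l (ltW e0) QE.
have := ler_wpM2l (mulr_ge0 (mulr_ge0 (ler0n _ 6) Age0) lge0) PE.
have : K * (m%:R + 2) < e * B ^+ 2 * (m%:R - 1) * (m%:R + 2) by rewrite ltr_pM2r//; lra.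
rewrite /K.
have el : 0 <= e * l ^+ 2 * (m%:R + 1) by rewrite !mulr_ge0// ltW.
have ebl : 0 <= e * B * l by rewrite !mulr_ge0// ltW.
have al : 0 <= A * l ^+ 2 * (m%:R + 1) by rewrite !mulr_ge0//; lra.
have eb : 0 <= e * B ^+ 2 by rewrite !mulr_ge0// ltW.
set M : R := m%:R in K2 m0 NP PE QE el al *. clearbody M. lra.
Qed.

Lemma interface_poly_root_near (R : realType) (a b : R[i]) (e : R) :
  a != 0 -> b != 0 -> a + b != 0 -> 0 < e ->
  \forall n \near \oo, exists2 w, root (interface_poly a b n) w & normc (a + b - w) < e.
Proof.
move=> a0 b0 l0 e0.
pose A := normc a; pose B := normc b; pose l := normc (a + b).
have B0 : 0 < B by rewrite lt_neqAle eq_sym normc_eq0 b0 normc_ge0.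
pose K := 6 * e * l ^+ 2 + 6 * e * B * l + 6 * A * l * (l + B).
near=> n; apply: interface_poly_root_close => //.
  by near: n; exact: nbhs_infty_ge.
rewrite -/A -/B -/l -/K mulrC -ltr_pdivrMr ?mulr_gt0 ?exprn_gt0// ltrBrDr.
by near: n; exact: nbhs_infty_gtr.
Unshelve. all: end_near. Qed.

(** * Upper bound on the roots *)

(** The combinations [w (j + 1) - t nu w j] and [w (j + 1) - t mu w j] are
    geometric sequences of ratios [t mu] and [t nu].  As [w n = 0], they agree up
    to a factor [mu^2] at [j = n - 1], which compares their initial terms; this
    also covers [mu = nu]. *)
Lemma interface_poly_root_joukowski (F : fieldType) (a b l mu nu : F) n :
  a != 0 -> l != 0 -> mu * nu = 1 ->
  (l - a * mu) * (l - a * nu) = b ^+ 2 -> root (interface_poly a b n) l ->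
  mu ^+ (2 * n.+1) * b ^+ 2 = (l - a * mu) ^+ 2.
Proof.
move=> a0 l0 mn bE; case: n => [|m]; first by rewrite /root hornerC oner_eq0.
pose t := a * l; pose w j := (interface_poly a b j).[l].
have wS j : w j.+2 = t * (mu + nu) * w j.+1 - t ^+ 2 * w j.
  rewrite /w interface_polySS !(hornerD, hornerN, hornerM, hornerC, hornerX) -bE /t.
  ring: mn.
have up j : w j.+1 - t * nu * w j = (t * mu) ^+ j * (w 1%N - t * nu * w 0%N).
  elim: j => [|j IH]; first by rewrite expr0 mul1r.
  rewrite exprS -[RHS]mulrA -IH wS.
  by ring: mn.
have down j : w j.+1 - t * mu * w j = (t * nu) ^+ j * (w 1%N - t * mu * w 0%N).
  elim: j => [|j IH]; first by rewrite expr0 mul1r.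
  rewrite exprS -[RHS]mulrA -IH wS.
  by ring: mn.
rewrite /root => /eqP wm; have {}wm : w m.+1 = 0 by [].
have w1 : w 1%N = l ^+ 2 - b ^+ 2 by rewrite /w /= !hornerE.
have w0 : w 0%N = 1 by rewrite /w hornerC.
have f0 : w 1%N - t * nu * w 0%N = a * mu * (l - a * nu).
  by rewrite w1 w0 mulr1 -bE /t; ring: mn.
have g0 : w 1%N - t * mu * w 0%N = a * nu * (l - a * mu).
  by rewrite w1 w0 mulr1 -bE /t; ring: mn.
have := up m; have := down m; rewrite wm f0 g0 !sub0r => dn upm.
have ta : a * t ^+ m != 0 by rewrite mulf_neq0// expf_neq0// mulf_neq0.
have mnX j : mu ^+ j * nu ^+ j = 1 by rewrite -exprMn mn expr1n.
have key : mu ^+ (2 * m.+2) * (l - a * nu) = l - a * mu.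
  apply: (mulfI ta).
  transitivity (mu ^+ m.+1 * (mu ^+ 2 * ((t * mu) ^+ m * (a * mu * (l - a * nu))))).
    by rewrite mul2n -addnn exprD (exprMn m t mu) !exprS; ring.
  have -> : mu ^+ 2 * ((t * mu) ^+ m * (a * mu * (l - a * nu)))
      = (t * nu) ^+ m * (a * nu * (l - a * mu)).
    by rewrite -upm -dn; ring: mn.
  rewrite (exprMn m t nu); have := mnX m.+1; rewrite !exprS => mnS.
  by ring: mnS.
by rewrite -bE mulrA [_ * (_ - a * mu)]mulrC -mulrA key expr2.
Qed.

Lemma exists_sum_prod (R : rcfType) (s p : R[i]) :
  exists x y : R[i], x + y = s /\ x * y = p.
Proof.
have [x xE] := solve_monicpoly
  (fun i => if i == 0%N then - p else if i == 1%N then s else 0 : R[i]) (ltn0Sn 1).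
move: xE; rewrite !big_ord_recl big_ord0 /= expr0 mulr1 expr1 addr0 => xE.
exists x, (s - x); split; first by ring.
by rewrite mulrBr -expr2 xE; ring.
Qed.

Lemma exists_joukowski (R : rcfType) (s : R[i]) :
  exists mu nu : R[i], [/\ mu * nu = 1, mu + nu = s & 1 <= normc mu].
Proof.
have [x [y [xs xy]]] := exists_sum_prod R s 1.
have [h|h] := leP 1 (normc x); first by exists x, y.
exists y, x; split; [by rewrite mulrC|by rewrite addrC|].
have := congr1 (@normc R) xy; rewrite normcM normc1 => n1.
rewrite leNgt; apply/negP => h2.
have := normc_ge0 _ x; have := normc_ge0 _ y; nra.
Qed.

Lemma bernoulli_le (R : realDomainType) (x : R) n : 1 <= x -> 1 + n%:R * (x - 1) <= x ^+ n.
Proof.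
move=> x1; elim: n => [|n IH]; first by rewrite mul0r addr0 expr0.
rewrite exprS -natr1.
have x0 : 0 <= x by apply: le_trans x1.
have n0 : 0 <= n%:R * (x - 1) ^+ 2 by rewrite mulr_ge0// sqr_ge0.
have := ler_wpM2l x0 IH; lra.
Qed.

(** [Q(l, c)] at the real point [c] nearest to [(mu + nu) / 2] is small because
    [|mu|] is close to 1, and at least [(|l| - m)^2] because both roots of
    [Q( . , c)] have modulus at most [m]. *)
Lemma interface_poly_root_le (R : rcfType) (a b l : R[i]) n :
  a != 0 -> b != 0 -> l != 0 -> root (interface_poly a b n) l ->
  let A := normc a in let B := normc b in
  let m := Num.max (normc (a + b)) (normc (a - b)) in
  m < normc l -> n%:R * (normc l - m) ^+ 2 <= 4 * A ^+ 2 * (A + B) / B.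
Proof.
move=> a0 b0 l0 rt A B m ml.
have B0 : 0 < B by rewrite lt_neqAle eq_sym normc_eq0 b0 normc_ge0.
have A0 : 0 < A by rewrite lt_neqAle eq_sym normc_eq0 a0 normc_ge0.
have [mu [nu [mn musum mu1]]] := exists_joukowski R ((l ^+ 2 + a ^+ 2 - b ^+ 2) / (a * l)).
have bE : (l - a * mu) * (l - a * nu) = b ^+ 2.
  have -> : (l - a * mu) * (l - a * nu) = l ^+ 2 - a * l * (mu + nu) + a ^+ 2 * (mu * nu) by ring.
  by rewrite mn musum mulrCA mulfV ?mulf_neq0//; ring.
have := congr1 (@normc R) (interface_poly_root_joukowski _ a b l mu nu n a0 l0 mn bE rt).
rewrite normcM !normc_exp -/B; set r := normc mu => rE.
rewrite -/r in mu1.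
have r0 : 0 < r by apply: lt_le_trans mu1.
have {}rE : r ^+ n.+1 * B = normc (l - a * mu).
  apply/eqP; rewrite -(eqrXn2 (ltn0Sn 1)) ?normc_ge0 ?mulr_ge0 ?exprn_ge0 ?(ltW r0) ?(ltW B0)//.
  by rewrite -rE exprMn mulnC exprM.
have r1n : 1 <= r ^+ n.+1 by rewrite exprn_ege1.
have lnu : normc (l - a * nu) <= B.
  have := congr1 (@normc R) bE; rewrite normcM normc_exp -rE -/B => E.
  have : r ^+ n.+1 * normc (l - a * nu) = B.
    by apply: (mulfI (lt0r_neq0 B0)); rewrite -expr2 -E; ring.
  by have := normc_ge0 _ (l - a * nu); nra.
have nuE : r * normc nu = 1 by rewrite -normcM mn normc1.
have nu1 : normc nu <= 1 by have := normc_ge0 _ nu; nra.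
have lle : normc l <= A + B.
  rewrite -[l](subrK (a * nu)); apply: le_trans (normc_triangle _ _ _) _.
  rewrite normcM -/A addrC lerD// ler_piMr// ltW//.
have rn : n%:R * (r - 1) * B <= 2 * A.
  have h1 : r ^+ n.+1 * B <= (A + B) + A * r.
    rewrite rE; apply: le_trans (normc_triangle _ _ _) _.
    by rewrite normc_opp normcM lerD.
  have h2 : r ^+ n * B <= 2 * A + B.
    rewrite -(ler_pM2l r0) mulrA -exprS; nra.
  have := ler_wpM2r (ltW B0) (bernoulli_le _ r n mu1); lra.
(* The cosine of the argument of [mu], the point of [-1, 1] next to
   [(mu + nu) / 2]. *)
pose c := complex.Re mu / r.
have c1 : `|c| <= 1.
  rewrite normrM normfV (gtr0_norm r0) ler_pdivrMr// mul1r.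
  rewrite -(ler_pXn2r (ltn0Sn 1)) ?nnegrE ?normc_ge0//.
  by rewrite real_normK ?num_real// normc_sqr lerDl sqr_ge0.
have cd : normc (mu + nu - 2 * c%:C) <= 2 * (r - 1).
  have rC : r%:C != 0 by rewrite -normc_eq0 normc_real normr_eq0 lt0r_neq0.
  (* The conjugate of [mu], which is [r^2 nu] as [nu] is the inverse of [mu]. *)
  pose muJ : R[i] := complex.Re mu -i* complex.Im mu.
  have muJE : muJ = r%:C ^+ 2 * nu.
    rewrite -rmorphXn normc_sqr -[LHS]mulr1 -mn mulrA; congr (_ * _).
    rewrite /muJ; case: (mu) => u v; apply/eqP; rewrite eq_complex /=.
    by apply/andP; split; apply/eqP; ring.
  have cE : 2 * c%:C * r%:C = mu + muJ.
    rewrite -mulrA -rmorphM divfK ?lt0r_neq0// /muJ; case: (mu) => u v.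
    by apply/eqP; rewrite eq_complex /=; apply/andP; split; apply/eqP; ring.
  have -> : mu + nu - 2 * c%:C = mu * (1 - r^-1)%:C + nu * (1 - r)%:C.
    apply: (mulIf rC); rewrite mulrBl cE muJE !rmorphB rmorph1 fmorphV.
    by rewrite !mulrDl -!mulrA !mulrBl mulVf//; ring.
  apply: le_trans (normc_triangle _ _ _) _; rewrite !normcM !normc_real -/r.
  rewrite ger0_norm ?subr_ge0 ?invf_le1// mulrBr mulfV ?lt0r_neq0// mulr1.
  by rewrite ler0_norm ?subr_le0// opprB; have := normc_ge0 _ nu; nra.
pose C := l ^+ 2 - 2 * a * l * c%:C + (a ^+ 2 - b ^+ 2).
have CE : C = a * l * (mu + nu - 2 * c%:C).
  by rewrite /C musum mulrBr mulrCA mulfV ?mulf_neq0//; ring.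
have [x [y [xs xy]]] := exists_sum_prod R (2 * a * c%:C) (a ^+ 2 - b ^+ 2).
have root_le z : z ^+ 2 - 2 * a * z * c%:C + (a ^+ 2 - b ^+ 2) = 0 -> normc l - m <= normc (l - z).
  move=> zE; rewrite lerBlDr; apply: le_trans (_ : normc (l - z) + normc z <= _).
    by rewrite -{1}[l](subrK z) normc_triangle.
  by rewrite lerD2l; exact: symbol_eigenvalue_le zE.
have CxyE : C = (l - x) * (l - y).
  rewrite /C -xy; transitivity (l ^+ 2 - 2 * a * c%:C * l + x * y); first by ring.
  by rewrite -xs; ring.
have xr : normc l - m <= normc (l - x).
  by apply: root_le; rewrite -xy; transitivity (x ^+ 2 - 2 * a * c%:C * x + x * y);
    [ring|rewrite -xs; ring].
have yr : normc l - m <= normc (l - y).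
  by apply: root_le; rewrite -xy; transitivity (y ^+ 2 - 2 * a * c%:C * y + x * y);
    [ring|rewrite -xs; ring].
have d0 : 0 <= normc l - m by rewrite subr_ge0 ltW.
have sqC : (normc l - m) ^+ 2 <= normc C by rewrite CxyE normcM expr2 ler_pM.
have Cle : normc C <= A * (A + B) * (2 * (r - 1)).
  by rewrite CE !normcM ler_pM ?mulr_ge0 ?normc_ge0// ler_pM ?normc_ge0.
rewrite ler_pdivlMr//.
have n0 : 0 <= n%:R :> R by [].
have := ler_wpM2l n0 (le_trans sqC Cle) => /(ler_wpM2r (ltW B0)) h.
apply: le_trans h _.
have AB0 : 0 <= 2 * A * (A + B) by rewrite !mulr_ge0// ?addr_ge0// ltW.
by have := ler_wpM2l AB0 rn; lra.
Qed.

(** * Spectrum of the iteration matrix *)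

Lemma mul_mxrow_tridiag (T : nzRingType) (n p : nat) (D U L : 'M[T]_p) (r : nat -> 'rV[T]_p) :
  (\mxrow_(i < n) r i) *m block_tridiag_toeplitz n D U L =
  \mxrow_(j < n) (r j *m D + (if (j : nat) is j'.+1 then r j' *m U else 0 : 'rV[T]_p)
     + (if (j.+1 < n)%N then r j.+1 *m L else 0 : 'rV[T]_p)).
Proof.
rewrite mul_mxrow_mxblock; apply: eq_mxrow => j.
transitivity (\sum_(i < n) ((if i == j then r i *m D else 0)
  + (if j == i.+1 :> nat then r i *m U else 0)
  + (if i == j.+1 :> nat then r i *m L else 0))).
  apply: eq_bigr => i _; rewrite -(inj_eq val_inj) /=.
  case: (eqVneq (i : nat) j) => [->|ij].
    by rewrite !ifN ?addr0 ?neq_ltn ?ltnSn ?orbT.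
  case: (eqVneq (j : nat) i.+1) => [->|ji]; last by rewrite !add0r; case: ifP; rewrite ?mulmx0.
  by rewrite ifN ?addr0 ?add0r// neq_ltn ltnS leqnSn.
rewrite !big_split /= -!big_mkcond /=; congr (_ + _ + _).
- by rewrite big_pred1_eq.
- case: j => -[|j] jn /=; first by rewrite big_pred0.
  by rewrite (big_pred1 (Ordinal (ltnW jn))).
- case: ifP => jn; first by rewrite (big_pred1 (Ordinal jn)).
  by rewrite big_pred0// => i; apply/negbTE; rewrite neq_ltn (leq_trans (ltn_ord i))// leqNgt jn.
Qed.

Definition interface_matrix {F : nzRingType} (a b : F) (n : nat) : 'M[F]_(\sum_(i < n) 2) :=
  block_tridiag_toeplitz n (b *: (delta_mx 0 1 + delta_mx 1 0))
    (a *: delta_mx 0 0) (a *: delta_mx 1 1).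

Lemma mul_row2_delta (F : comNzRingType) (v : 'rV[F]_2) (c : F) (i j k : 'I_2) :
  (v *m (c *: delta_mx i j)) 0 k = if k == j then c * v 0 i else 0.
Proof.
rewrite -scalemxAr mxE mxE (bigD1 i)//= mxE eqxx big1 ?addr0 => [|m mi].
  by case: ifP => _; rewrite ?mulr1 ?mulr0.
by rewrite mxE (negbTE mi) mulr0.
Qed.

Lemma row2P (F : eqType) (u v : 'rV[F]_2) : u = v <-> u 0 0 = v 0 0 /\ u 0 1 = v 0 1.
Proof.
split=> [->//|[h0 h1]]; apply/rowP => -[[|[|//]] i2].
  by rewrite (_ : Ordinal i2 = 0)//; exact: val_inj.
by rewrite (_ : Ordinal i2 = 1)//; exact: val_inj.
Qed.

(** Here [x i] and [y (i + 1)] are the second and first components of the block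
    [i] of a row eigenvector.  The shift of [y] turns the missing neighbours at
    both ends into the boundary conditions [y 0 = 0] and [x n = 0]. *)
Lemma eigenvalue_interfaceP (F : fieldType) (a b l : F) n :
  eigenvalue (interface_matrix a b n) l <->
  exists x y : nat -> F, [/\ y 0%N = 0, x n = 0,
    forall i, (i < n)%N -> l * y i.+1 = b * x i + a * y i /\ l * x i = b * y i.+1 + a * x i.+1
    & exists2 i, (i < n)%N & (x i != 0) || (y i.+1 != 0)].
Proof.
have stepE (r : nat -> 'rV[F]_2) (j : 'I_n) :
    let w := r j *m (b *: (delta_mx 0 1 + delta_mx 1 0))
       + (if (j : nat) is j'.+1 then r j' *m (a *: delta_mx 0 0) else 0 : 'rV[F]_2)
       + (if (j.+1 < n)%N then r j.+1 *m (a *: delta_mx 1 1) else 0 : 'rV[F]_2) in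
    w 0 0 = b * r j 0 1 + (if (j : nat) is j'.+1 then a * r j' 0 0 else 0) /\
    w 0 1 = b * r j 0 0 + (if (j.+1 < n)%N then a * r j.+1 0 1 else 0).
  have addE (u v : 'rV[F]_2) k : (u + v) 0 k = u 0 k + v 0 k by rewrite mxE.
  rewrite /= scalerDr mulmxDr; case: (j : nat) => [|j']; case: ifP => _;
    by rewrite !addE !mul_row2_delta /= ?mxE ?addr0 ?add0r.
have rowE (r : nat -> 'rV[F]_2) :
    (\mxrow_(i < n) r i) *m interface_matrix a b n = l *: \mxrow_(i < n) r i <->
    forall j : 'I_n,
    l * r j 0 0 = b * r j 0 1 + (if (j : nat) is j'.+1 then a * r j' 0 0 else 0) /\
    l * r j 0 1 = b * r j 0 0 + (if (j.+1 < n)%N then a * r j.+1 0 1 else 0).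
  have -> : l *: (\mxrow_(i < n) r i) = \mxrow_(i < n) (l *: r i).
    by apply/matrixP => u v; rewrite !mxE.
  rewrite mul_mxrow_tridiag; split=> [/eq_mxrowP eq j|eq].
    by have [<- <-] := stepE r j; rewrite eq !mxE.
  apply/eq_mxrowP => j; apply/row2P; have [-> ->] := stepE r j.
  by have [<- <-] := eq j; rewrite !mxE.
split.
  move=> /eigenvalueP [v vE v0].
  pose r k : 'rV[F]_2 := if insub k is Some i then submxrow v i else 0.
  have vr : v = \mxrow_(i < n) r i.
    by rewrite -[LHS]submxrowK; apply: eq_mxrow => i; rewrite /r valK.
  have rn : r n = 0 by rewrite /r insubF ?ltnn.
  exists (fun k => r k 0 1), (fun k => if k is k'.+1 then r k' 0 0 else 0).
  move: vE; rewrite vr => /rowE step; split=> //; first by rewrite rn mxE.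
    move=> i lin; have [/= -> ->] := step (Ordinal lin).
    split; first by case: i {lin} => [|i]; rewrite ?mulr0.
    congr (_ + _); case: ifP => // /negbT; rewrite -leqNgt => ni.
    by rewrite (_ : i.+1 = n) ?rn ?mxE ?mulr0//; apply/eqP; rewrite eqn_leq lin.
  apply: contra_neqP v0 => no; rewrite vr -[RHS](@mxrow0 _ n (fun=> 2%N) 1).
  apply: eq_mxrow => j; apply/row2P; rewrite !mxE.
  split; apply/eqP; apply/negP => /negP nz; apply: no; exists j => //.
    by rewrite nz orbT.
  by rewrite nz.
move=> [x [y [y0 xn step [i0 lin nz]]]].
pose r k : 'rV[F]_2 := \row_(m < 2) if m == 0 then y k.+1 else x k.
apply/eigenvalueP; exists (\mxrow_(i < n) r i).
  apply/rowE => j; rewrite !mxE /=.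
  have [-> ->] := step j (ltn_ord j); split.
    by case: (j : nat) => [|j']; rewrite ?y0 ?mulr0// ?mxE.
  congr (_ + _); case: ifP => [_|/negbT]; first by rewrite ?mxE.
  rewrite -leqNgt => nj; rewrite (_ : j.+1 = n) ?xn ?mulr0//.
  by apply/eqP; rewrite eqn_leq ltn_ord.
apply: contraTneq nz; rewrite -[RHS](@mxrow0 _ n (fun=> 2%N) 1) => /eq_mxrowP /(_ (Ordinal lin)) /row2P.
by rewrite !mxE /= => -[-> ->]; rewrite eqxx.
Qed.

(** For [a] and [l] nonzero, the equations determine all unknowns from [x 0], and
    [(a l)^i x i] follows the recurrence of the polynomials, so that the
    condition [x n = 0] is the vanishing of the last one. *)
Lemma eigenvalue_interface_matrix (F : fieldType) (a b l : F) n :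
  a != 0 -> l != 0 ->
  eigenvalue (interface_matrix a b n) l <-> root (interface_poly a b n) l.
Proof.
move=> a0 l0.
have polyE (x y : nat -> F) : y 0%N = 0 ->
    (forall i, (i < n)%N -> l * y i.+1 = b * x i + a * y i /\ l * x i = b * y i.+1 + a * x i.+1) ->
    forall i, (i <= n)%N -> (a * l) ^+ i * x i = (interface_poly a b i).[l] * x 0%N.
  move=> y0 step; elim/nat_pair_ind => [||i IH IH1] lin.
  - by rewrite hornerC expr0.
  - have [e1 e2] := step 0%N lin; rewrite y0 in e1.
    rewrite expr1 /= !(hornerD, hornerN, hornerC, hornerXn).
    have -> : a * l * x 1%N = l * (l * x 0%N) - b * (l * y 1%N) by rewrite e2; ring.
    by rewrite e1; ring.
  have [e1 e2] := step i (ltnW lin); have [e3 e4] := step i.+1 lin.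
  rewrite interface_polySS !(hornerD, hornerN, hornerM, hornerC, hornerX).
  have {}IH := IH (ltnW (ltnW lin)); have {}IH1 := IH1 (ltnW lin).
  transitivity ((l ^+ 2 + (a ^+ 2 - b ^+ 2)) * ((a * l) ^+ i.+1 * x i.+1)
    - (a * l) ^+ 2 * ((a * l) ^+ i * x i)); last by rewrite IH1 IH; ring.
  have -> : (a * l) ^+ i.+2 * x i.+2 = (a * l) ^+ i.+1 * ((l ^+ 2 + (a ^+ 2 - b ^+ 2)) * x i.+1 - a * l * x i).
    rewrite exprSr -mulrA; congr (_ * _).
    have -> : a * l * x i.+2 = l * (l * x i.+1 - b * y i.+2) by rewrite e4; ring.
    have -> : l * (l * x i.+1 - b * y i.+2) = l ^+ 2 * x i.+1 - b * (l * y i.+2) by ring.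
    have be : b * (a * y i.+1) = a * (l * x i - a * x i.+1) by rewrite e2; ring.
    by rewrite e3 mulrDr be; ring.
  by rewrite !exprS; ring.
split.
  move=> /eigenvalue_interfaceP [x [y [y0 xn step [i0 lin nz]]]].
  have := polyE x y y0 step n (leqnn n); rewrite xn mulr0 => /esym/eqP.
  rewrite mulf_eq0 => /orP[//|/eqP x0]; exfalso; move: nz.
  have z i : (i <= n)%N -> x i = 0 /\ y i = 0.
    elim: i => [//|i IH] ltin; have [xi yi] := IH (ltnW ltin).
    have [e1 e2] := step i ltin.
    have yS : y i.+1 = 0.
      by apply: (mulfI l0); rewrite e1 xi yi !mulr0 addr0.
    split=> //; apply: (mulfI a0).
    by move: e2; rewrite xi yS !mulr0 add0r => <-.
  by have [-> _] := z _ (ltnW lin); have [_ ->] := z _ lin; rewrite eqxx.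
move=> rt.
pose st := fix st i := if i is i'.+1 then
   let: (x, y) := st i' in let y' := (b * x + a * y) / l in ((l * x - b * y') / a, y')
   else (1, 0).
have step i : (i < n)%N -> l * (st i.+1).2 = b * (st i).1 + a * (st i).2 /\
    l * (st i).1 = b * (st i.+1).2 + a * (st i.+1).1.
  move=> _ /=; case: (st i) => x y /=.
  by split; [rewrite mulrC divfK|rewrite (mulrC a (_ / a)) divfK// addrCA subrr addr0].
have n0 : (0 < n)%N by case: (n) rt => //; rewrite /root hornerC oner_eq0.
apply/eigenvalue_interfaceP; exists (fun i => (st i).1), (fun i => (st i).2).
split=> //; last by exists 0%N => //=; rewrite oner_eq0.
have := polyE _ _ erefl step n (leqnn n); rewrite (eqP rt) mul0r => /eqP.
by rewrite mulf_eq0 expf_eq0 mulf_eq0 (negbTE a0) (negbTE l0) andbF => /eqP.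
Qed.

(** * The limit of the spectral radii *)

Lemma interface_polyN (F : nzRingType) (a b : F) n :
  interface_poly a (- b) n = interface_poly a b n.
Proof.
by elim/nat_pair_ind: n => [||n IH IH1]; rewrite ?interface_polySS ?IH ?IH1 /= ?sqrrN.
Qed.

Lemma spectral_radius_interface_cvg (R : realType) (a b : R[i]) :
  a != 0 -> b != 0 ->
  spectral_radius (interface_matrix a b n) @[n --> \oo] -->
  Num.max (normc (a + b)) (normc (a - b)).
Proof.
move=> a0 b0.
(* The polynomials do not see the sign of [b], so the edge of larger modulus may
   be taken to be [a + b']. *)
have [b' [mE b'0 polyE]] : exists b', [/\ Num.max (normc (a + b)) (normc (a - b)) = normc (a + b'),
    b' != 0 & forall n, interface_poly a b' n = interface_poly a b n].
  case: (leP (normc (a + b)) (normc (a - b))) => _; last by exists b.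
  by exists (- b); rewrite oppr_eq0; split=> // n; exact: interface_polyN.
set m := Num.max _ _ in mE *.
have m0 : 0 < m.
  rewrite lt_neqAle {2}mE normc_ge0 andbT eq_sym; apply: contra_neqN b0 => /eqP m0.
  have : normc (2 * b) <= normc (a + b) + normc (a - b).
    rewrite (_ : 2 * b = (a + b) - (a - b)); last by ring.
    by apply: le_trans (normc_triangle _ _ _) _; rewrite normc_opp.
  have h1 : normc (a + b) <= m by rewrite le_max lexx.
  have h2 : normc (a - b) <= m by rewrite le_max lexx orbT.
  have b1 := normc_ge0 _ b.
  rewrite normcM normc_nat => h3; apply: eq0_normc; lra.
have l0 : a + b' != 0 by rewrite -normc_eq0 -mE lt0r_neq0.
apply/cvgrPdist_le => e e0.
pose C := 4 * normc a ^+ 2 * (normc a + normc b) / normc b.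
near=> n.
have ub l : eigenvalue (interface_matrix a b n) l -> normc l <= m + e.
  move=> lev; rewrite leNgt; apply/negP => lt.
  have [l00|l00] := eqVneq l 0; first by move: lt; rewrite l00 normc0; lra.
  have rt := (eigenvalue_interface_matrix _ _ _ _ _ a0 l00).1 lev.
  have ml : m < normc l by lra.
  have := interface_poly_root_le _ _ _ _ _ a0 b0 l00 rt ml; rewrite -/C -/m => h.
  have nC : C < n%:R * e ^+ 2.
    by rewrite -ltr_pdivrMr ?exprn_gt0//; near: n; exact: nbhs_infty_gtr.
  have : n%:R * e ^+ 2 <= n%:R * (normc l - m) ^+ 2.
    rewrite ler_wpM2l// ler_sqr ?nnegrE; lra.
  lra.
(* Distance less than [m = |a + b'|] keeps the root away from 0, where roots and
   eigenvalues need not correspond. *)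
have [w rt wl] : exists2 w, root (interface_poly a b n) w & normc (a + b' - w) < Num.min e m.
  rewrite -polyE; near: n; apply: interface_poly_root_near => //.
  by rewrite lt_min e0.
have {wl}[we wm] : normc (a + b' - w) < e /\ normc (a + b' - w) < m.
  by move: wl; rewrite lt_min => /andP.
have w0 : w != 0 by apply: contraTneq wm => ->; rewrite subr0 -mE ltxx.
have wev := (eigenvalue_interface_matrix _ _ _ _ n a0 w0).2 rt.
set S := [set normc x | x in [set x | eigenvalue (interface_matrix a b n) x]].
have Sw : S (normc w) by exists w.
have Sub : ubound S (m + e) by move=> _ [l lev <-]; exact: ub.
have le1 : normc w <= sup S by apply: ub_le_sup => //; exists (m + e).
have le2 : sup S <= m + e by apply: ge_sup => //; exists (normc w).
have mw : m - e <= normc w.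
  have := normc_triangle _ (a + b' - w) w; rewrite subrK -mE; lra.
by rewrite /spectral_radius -/S ler_distlC; apply/andP; split; lra.
Unshelve. all: end_near. Qed.

Theorem theorem3p3 (R : realType) (k sigma delta L : R)
    (hk : 0 < k) (hsigma : 0 < sigma) (hdelta : 0 < delta) (hL : 0 < L) :
  let alpha : R[i] := 0 +i* k in
  [/\ rho_1d alpha k sigma delta L N @[N --> \oo] --> R_1d alpha k sigma delta L,
      R_1d alpha k sigma delta L < 1
    & exists2 q : R, q < 1 &
        \forall N \near \oo, rho_1d alpha k sigma delta L N <= q].
Proof.
move=> alpha.
pose a := robin_a alpha k sigma delta L; pose b := robin_b alpha k sigma delta L.
have a0 : a != 0 by exact: robin_a_neq0.
have b0 : b != 0 by exact: robin_b_neq0.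
pose m := Num.max (normc (a + b)) (normc (a - b)).
have m1 : m < 1.
  have h0 : 0 < L / 2 by rewrite divr_gt0.
  have LE : L = (L / 2) *+ 2 by rewrite [RHS]mulr2n; lra.
  have mod1 (s : R) : s ^+ 2 = 1 -> normc (a - s%:C * b) < 1.
    move=> s1; rewrite /a /b LE robin_abE//.
    have [p [q [zE p0 q0 qE]]] := zetaP _ _ _ hk hsigma.
    rewrite normcM normcV zE ltr_pdivrMr ?mul1r; first exact: normc_robin_wave_lt.
    rewrite -zE lt_neqAle normc_ge0 andbT eq_sym normc_eq0.
    by rewrite robin_wave_neq0// addr_gt0.
  have := mod1 1 (expr1n _ _); have := mod1 (- 1) (etrans (sqrrN 1) (expr1n _ _)).
  rewrite rmorphN rmorph1 mulN1r opprK mul1r => h1 h2.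
  by rewrite gt_max h1 h2.
have cv : rho_1d alpha k sigma delta L N @[N --> \oo] --> m.
  by rewrite -cvg_shiftS; exact: spectral_radius_interface_cvg.
have limE : R_1d alpha k sigma delta L = m by exact/cvg_lim.
rewrite limE; split=> //; exists ((m + 1) / 2); first by lra.
by apply: (cvgr_le m cv); lra.
Qed.
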